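(* Let $A\in\mathbb{R}^{n\times n}$, $b_1,\dots,b_m\in\mathbb{R}^n$ with $m\ge1$, and $T>0$. Let $S=\{i_1,\dots,i_k\}\subseteq\{1,\dots,m\}$ be a nonempty set of $k=|S|$ indices with a fixed ordering, let $C_S:=\{p\in\Delta_m\mid p_i=0\text{ for every }i\notin S\}$, $\mathcal L_{C_S}:=\operatorname{lin}(C_S-C_S)$, and $E_S:=[\,e^{(m)}_{i_1}\ \cdots\ e^{(m)}_{i_k}\,]\in\mathbb{R}^{m\times k}$. Then: 1. The map $q\mapsto E_Sq$ is a bijection from $\Delta_k$ onto $C_S$. In particular, every $p\in C_S$ has a unique representation $p=E_Sq$ with $q\in\Delta_k$. 2. For $q\in\Delta_k$, $\Phi_T(E_Sq)=\sum_{j=1}^kq_jW_{i_j}(T)$. 3. For every $z\in\mathbb{R}^m$, $P_{C_S}(z)=E_SP_{\Delta_k}(E_S^\top z)$. 4. $\mathcal L_{C_S}=\{E_Sz\mid z\in\mathbb{R}^k,\ \mathbf 1^\top z=0\}$.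
   Context: $\Delta_m:=\{p\in\mathbb{R}^m\mid p_i\ge0,\ \sum_{i=1}^m p_i=1\}$ (and $\Delta_k$ likewise in $\mathbb{R}^k$); $W_i(T):=\int_0^T e^{At}b_ib_i^\top e^{A^\top t}\,dt$; $\Phi_T(v):=\sum_{i=1}^m v_iW_i(T)$ for $v\in\mathbb{R}^m$. $e^{(m)}_i$ is the $i$th standard basis vector of $\mathbb{R}^m$; $\mathbf 1$ is the all-ones vector; $P_K$ is the Euclidean projection onto a nonempty closed convex set $K$; $C_S-C_S=\{p-q\mid p,q\in C_S\}$; $\operatorname{lin}$ is linear span. *)

(* Defs.v *)
From HB Require Import structures.
From mathcomp Require Import all_boot all_order all_algebra.
From mathcomp Require Import all_classical all_reals all_analysis.

Set Implicit Arguments.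
Unset Strict Implicit.
Unset Printing Implicit Defensive.

Import Order.TTheory GRing.Theory Num.Theory.
Import numFieldNormedType.Exports.

Local Open Scope classical_set_scope.
Local Open Scope ring_scope.

Definition expmx (R : realType) (n : nat) (A : 'M[R]_n) : 'M[R]_n :=
  limn (series (fun k : nat => (k`!%:R)^-1 *: A ^+ k)).

(* The matrix-valued integral is taken entrywise.  Its integrand is continuous,
   so the Lebesgue integral over [0, T] is the Riemann one. *)
Definition gramian (R : realType) (n : nat) (A : 'M[R]_n) (b : 'cV[R]_n)
    (T : R) : 'M[R]_n :=
  \matrix_(r, s) \int[lebesgue_measure]_(t in `[0, T])
    (expmx (t *: A) *m b *m b^T *m expmx (t *: A^T)) r s.

Definition Phi (R : realType) (n m : nat) (A : 'M[R]_n) (b : 'I_m -> 'cV[R]_n)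
    (T : R) (v : 'cV[R]_m) : 'M[R]_n :=
  \sum_(i < m) v i 0 *: gramian A (b i) T.

Definition simplex (R : realType) (m : nat) : set 'cV[R]_m :=
  [set p | (forall i, 0 <= p i 0) /\ \sum_(i < m) p i 0 = 1].
Arguments simplex : clear implicits.

Definition face (R : realType) (m : nat) (S : {set 'I_m}) : set 'cV[R]_m :=
  [set p | simplex R m p /\ forall i, i \notin S -> p i 0 = 0].
Arguments face R {m} S.

Definition stdbasis (R : realType) (m : nat) (i : 'I_m) : 'cV[R]_m :=
  delta_mx i 0.
Arguments stdbasis R {m} i.

Definition selmx (R : realType) (m k : nat) (idx : 'I_k -> 'I_m) :
    'M[R]_(m, k) :=
  \matrix_(r, j) stdbasis R (idx j) r 0.
Arguments selmx R {m k} idx.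

(* The norm `|v| that the library puts on matrices is the max norm. *)
Definition enorm (R : realType) (m : nat) (v : 'cV[R]_m) : R :=
  Num.sqrt (\sum_(i < m) v i 0 ^+ 2).

(* The point of K nearest to z.  It exists and is unique when K is nonempty,
   closed and convex; the default value 0 is irrelevant in that case. *)
Definition eucl_proj (R : realType) (m : nat) (K : set 'cV[R]_m) (z : 'cV[R]_m) :
    'cV[R]_m :=
  xget 0 [set p | K p /\ forall q, K q -> enorm (z - p) <= enorm (z - q)].

Definition diffset (R : realType) (m : nat) (X Y : set 'cV[R]_m) :
    set 'cV[R]_m :=
  [set p - q | p in X & q in Y].

Definition lin (R : realType) (m : nat) (X : set 'cV[R]_m) : set 'cV[R]_m :=
  [set v | exists (N : nat) (c : 'I_N -> R) (x : 'I_N -> 'cV[R]_m),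
    (forall l, X (x l)) /\ v = \sum_(l < N) c l *: x l].

(* Main.v *)
Require Import Defs.
From HB Require Import structures.
From mathcomp Require Import all_boot all_order all_algebra.
From mathcomp Require Import all_classical all_reals all_analysis.
From mathcomp Require Import ring lra.

Set Implicit Arguments.
Unset Strict Implicit.
Unset Printing Implicit Defensive.

Import Order.TTheory GRing.Theory Num.Theory.
Import numFieldNormedType.Exports.

Local Open Scope classical_set_scope.
Local Open Scope ring_scope.

(** The matrix [E = selmx R idx] of an injective indexing is an isometric
    embedding, [E^T E = 1], whose range is the space of vectors supported on
    the image [S] of [idx]; there [E E^T] is the identity.  Since [E] only moves
    coordinates around and pads with zeros, it preserves nonnegativity and
    coordinate sums, so it carries the simplex bijectively onto the face, with
    inverse [E^T].

    The Gramian identity and the preservation of coordinate sums are two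
    instances of one reindexing formula, [selmx_sum].

    For the projections, Pythagoras' identity ([sqnorm_sub_selmx]) says that
    [|z - E q|^2] and [|E^T z - q|^2] differ by a quantity independent of [q], so
    that [E] carries the nearest points of the simplex to [E^T z] bijectively
    onto the nearest points of the face to [z].  By the parallelogram law a
    convex set has at most one nearest point to a given point, so matching the
    sets of nearest points is enough to match the projections; if both
    sets were empty, both projections would be the default [0 = E 0].

    Finally, a vector [z] with zero coordinate sum equals
    [\sum_j z_j (e_j - e_j0)] for any fixed [j0], which is a combination of
    differences of vertices of the simplex. *)

(** * The selection matrix *)

Section Selection.
Variables (R : realType) (m k : nat) (idx : 'I_k -> 'I_m).
Local Notation E := (selmx R idx).

Lemma selmxE i j : E i j = (i == idx j)%:R.
Proof. by rewrite !mxE eqxx andbT. Qed.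

Lemma tr_selmx_mulE (z : 'cV[R]_m) j : (E^T *m z) j 0 = z (idx j) 0.
Proof.
rewrite mxE (bigD1 (idx j)) //= mxE selmxE eqxx mul1r big1 ?addr0 // => i ij.
by rewrite mxE selmxE (negbTE ij) mul0r.
Qed.

(** Weighting a family by [E q] and summing is the same as weighting the selected
    subfamily by [q]; taking the family constantly equal to [1] shows that [E]
    preserves coordinate sums. *)
Lemma selmx_sum (V : lmodType R) (F : 'I_m -> V) (q : 'cV[R]_k) :
  \sum_(i < m) (E *m q) i 0 *: F i = \sum_(j < k) q j 0 *: F (idx j).
Proof.
under eq_bigr => i _ do rewrite mxE scaler_suml.
rewrite exchange_big; apply: eq_bigr => j _ /=.
rewrite (bigD1 (idx j)) //= selmxE eqxx mul1r big1 ?addr0 // => i ij.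
by rewrite selmxE (negbTE ij) mul0r scale0r.
Qed.

Lemma sum_selmx_mul (q : 'cV[R]_k) :
  \sum_(i < m) (E *m q) i 0 = \sum_(j < k) q j 0.
Proof.
have /= := selmx_sum (fun=> 1 : R^o) q.
by under eq_bigr do rewrite /GRing.scale /= mulr1;
  under [RHS]eq_bigr do rewrite /GRing.scale /= mulr1.
Qed.

Lemma selmx_mul_ge0 (q : 'cV[R]_k) i :
  (forall j, 0 <= q j 0) -> 0 <= (E *m q) i 0.
Proof.
by move=> q0; rewrite mxE sumr_ge0 // => j _; rewrite selmxE mulr_ge0 ?ler0n.
Qed.

Hypothesis idx_inj : injective idx.

Lemma tr_selmxK : E^T *m E = 1%:M.
Proof.
apply/matrixP => j l; rewrite mxE (bigD1 (idx j)) //= mxE !selmxE eqxx mul1r.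
rewrite (inj_eq idx_inj) big1 ?addr0 ?mxE // => i ij.
by rewrite mxE !selmxE (negbTE ij) mul0r.
Qed.

Lemma selmx_mulK : cancel (fun q : 'cV[R]_k => E *m q) (mulmx E^T).
Proof. by move=> q; rewrite mulmxA tr_selmxK mul1mx. Qed.

Variable S : {set 'I_m}.
Hypothesis idx_im : [set idx j | j : 'I_k]%SET = S.

Lemma selmx_mul_off (q : 'cV[R]_k) i : i \notin S -> (E *m q) i 0 = 0.
Proof.
rewrite -idx_im => iS; rewrite mxE big1 // => j _; rewrite selmxE.
by case: eqP iS => [-> /imsetP[]|_ _]; [exists j | rewrite mul0r].
Qed.

Lemma selmx_mulVK (p : 'cV[R]_m) :
  (forall i, i \notin S -> p i 0 = 0) -> E *m (E^T *m p) = p.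
Proof.
move=> p0; apply/colP => i; have [|iS] := boolP (i \in S); last first.
  by rewrite selmx_mul_off ?p0.
by rewrite -idx_im => /imsetP[j _ ->];
  rewrite -tr_selmx_mulE selmx_mulK tr_selmx_mulE.
Qed.

Lemma face_selmx (q : 'cV[R]_k) : simplex R k q -> face R S (E *m q).
Proof.
move=> [q0 q1]; split; last by move=> i; exact: selmx_mul_off.
by split=> [i|]; [exact: selmx_mul_ge0 | rewrite sum_selmx_mul].
Qed.

Lemma simplex_tr_selmx (p : 'cV[R]_m) : face R S p -> simplex R k (E^T *m p).
Proof.
move=> [[p0 p1] pS]; split=> [j|]; first by rewrite tr_selmx_mulE.
by rewrite -sum_selmx_mul selmx_mulVK.
Qed.

Lemma face_selmxP (p : 'cV[R]_m) :
  face R S p <-> exists2 q, simplex R k q & E *m q = p.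
Proof.
split=> [pF|[q qD <-]]; last exact: face_selmx.
exists (E^T *m p); first exact: simplex_tr_selmx.
by apply: selmx_mulVK => i; apply: pF.2.
Qed.

End Selection.

(** * Nearest points *)

(** The squared Euclidean norm, as a matrix product so that Pythagoras' identity
    is matrix algebra. *)
Definition sqnorm (R : realType) (m : nat) (v : 'cV[R]_m) : R := (v^T *m v) 0 0.

Definition nearest (R : realType) (m : nat) (K : set 'cV[R]_m) (z : 'cV[R]_m) :
    set 'cV[R]_m :=
  [set p | K p /\ forall q, K q -> enorm (z - p) <= enorm (z - q)].

Lemma sqnormE (R : realType) (m : nat) (v : 'cV[R]_m) :
  sqnorm v = \sum_(i < m) v i 0 ^+ 2.
Proof. by rewrite /sqnorm mxE; apply: eq_bigr => i _; rewrite mxE expr2. Qed.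

Lemma sqnorm_ge0 (R : realType) (m : nat) (v : 'cV[R]_m) : 0 <= sqnorm v.
Proof. by rewrite sqnormE sumr_ge0 // => i _; rewrite sqr_ge0. Qed.

Lemma sqnorm_le0 (R : realType) (m : nat) (v : 'cV[R]_m) :
  sqnorm v <= 0 -> v = 0.
Proof.
move=> v0; apply/colP => i; rewrite mxE; apply/eqP; rewrite -sqrf_eq0.
have /eqP : sqnorm v = 0 by apply/eqP; rewrite eq_le v0 sqnorm_ge0.
rewrite sqnormE psumr_eq0 => [/allP/(_ i)|j _]; last by rewrite sqr_ge0.
by rewrite mem_index_enum => /(_ isT).
Qed.

Lemma ler_enorm (R : realType) (m l : nat) (v : 'cV[R]_m) (w : 'cV[R]_l) :
  (enorm v <= enorm w) = (sqnorm v <= sqnorm w).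
Proof.
rewrite /enorm -!sqnormE; apply/idP/idP; last exact: ler_wsqrtr.
move=> h; rewrite -(sqr_sqrtr (sqnorm_ge0 v)) -(sqr_sqrtr (sqnorm_ge0 w)).
by rewrite ler_sqr ?nnegrE ?sqrtr_ge0.
Qed.

Lemma sqnorm_midpoint (R : realType) (m : nat) (z p q : 'cV[R]_m) :
  sqnorm (z - 2^-1 *: (p + q)) * 4 + sqnorm (p - q) =
    sqnorm (z - p) * 2 + sqnorm (z - q) * 2.
Proof.
rewrite !sqnormE !mulr_suml -!big_split; apply: eq_bigr => i _ /=.
by rewrite !mxE; field.
Qed.

(** By the parallelogram law, the midpoint of two distinct nearest points would
    be strictly nearer. *)
Lemma nearest_unique (R : realType) (m : nat) (K : set 'cV[R]_m) z p q :
  (forall x y, K x -> K y -> K (2^-1 *: (x + y))) ->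
  nearest K z p -> nearest K z q -> p = q.
Proof.
move=> Kmid [Kp pmin] [Kq qmin]; apply/eqP; rewrite -subr_eq0; apply/eqP.
apply: sqnorm_le0; have := sqnorm_midpoint z p q.
have := pmin _ (Kmid _ _ Kp Kq); have := qmin _ (Kmid _ _ Kp Kq).
by rewrite !ler_enorm; lra.
Qed.

Lemma simplex_midpoint (R : realType) (m : nat) (x y : 'cV[R]_m) :
  simplex R m x -> simplex R m y -> simplex R m (2^-1 *: (x + y)).
Proof.
move=> [x0 x1] [y0 y1]; split=> [i|].
  by rewrite !mxE mulr_ge0 ?invr_ge0 ?addr_ge0.
under eq_bigr do rewrite !mxE.
by rewrite -mulr_sumr big_split /= x1 y1; field.
Qed.

Section Projection.
Variables (R : realType) (m k : nat) (idx : 'I_k -> 'I_m) (S : {set 'I_m}).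
Hypotheses (idx_inj : injective idx) (idx_im : [set idx j | j : 'I_k]%SET = S).
Local Notation E := (selmx R idx).

(** Pythagoras: [z - E E^T z] is orthogonal to the range of [E], on which [E^T]
    is an isometry. *)
Lemma sqnorm_sub_selmx (z : 'cV[R]_m) (q : 'cV[R]_k) :
  sqnorm (z - E *m q) = sqnorm (z - E *m (E^T *m z)) + sqnorm (E^T *m z - q).
Proof.
set u := E^T *m z - q; set w := z - E *m (E^T *m z).
have -> : z - E *m q = w + E *m u by rewrite /w /u mulmxBr addrA subrK.
have Ew : E^T *m w = 0 by rewrite /w mulmxBr (selmx_mulK idx_inj) subrr.
have wE : w^T *m E = 0 by rewrite -[E]trmxK -trmx_mul Ew trmx0.
clearbody u w; rewrite /sqnorm [(w + _)^T]linearD /= mulmxDl !mulmxDr trmx_mul.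
rewrite (mulmxA _ E u) wE mul0mx addr0.
rewrite -!mulmxA Ew mulmx0 add0r (mulmxA E^T) (tr_selmxK _ idx_inj).
by rewrite mul1mx mxE.
Qed.

Lemma ler_enorm_selmx (z : 'cV[R]_m) (q q' : 'cV[R]_k) :
  (enorm (z - E *m q) <= enorm (z - E *m q')) =
    (enorm (E^T *m z - q) <= enorm (E^T *m z - q')).
Proof.
by rewrite !ler_enorm (sqnorm_sub_selmx z q) (sqnorm_sub_selmx z q') lerD2l.
Qed.

Lemma nearest_selmx (z : 'cV[R]_m) (q : 'cV[R]_k) :
  nearest (face R S) z (E *m q) <-> nearest (simplex R k) (E^T *m z) q.
Proof.
split=> -[qK qmin]; split.
- by rewrite -(selmx_mulK idx_inj q);
    exact: (simplex_tr_selmx idx_inj idx_im).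
- by move=> q' /(face_selmx idx_im)/qmin; rewrite ler_enorm_selmx.
- exact: (face_selmx idx_im).
- move=> _ /(face_selmxP idx_inj idx_im)[q' q'D <-].
  by rewrite ler_enorm_selmx; exact: qmin.
Qed.

Lemma eucl_proj_face (z : 'cV[R]_m) :
  eucl_proj (face R S) z = E *m eucl_proj (simplex R k) (E^T *m z).
Proof.
rewrite /eucl_proj -/(nearest _ z) -/(nearest _ (E^T *m z)).
case: xgetP => [p _ pN|noF].
  have /(face_selmxP idx_inj idx_im)[q _ qp] := pN.1.
  rewrite -qp; congr (_ *m _); rewrite -qp in pN.
  move/nearest_selmx : pN => qN; case: xgetP => [q' _ q'N|/(_ q)//].
  exact: nearest_unique (@simplex_midpoint R k) qN q'N.
case: xgetP => [q _ /nearest_selmx/noF//|_].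
by rewrite mulmx0.
Qed.

End Projection.

(** * The direction space *)

Lemma simplex_stdbasis (R : realType) (k : nat) (j : 'I_k) :
  simplex R k (stdbasis R j).
Proof.
split=> [i|]; first by rewrite mxE ler0n.
rewrite (bigD1 j) //= mxE !eqxx big1 ?addr0 // => i ij.
by rewrite mxE (negbTE ij).
Qed.

Lemma ones_mulmx_eq0 (R : realType) (k : nat) (z : 'cV[R]_k) :
  (const_mx 1 : 'cV[R]_k)^T *m z = 0 <-> \sum_(j < k) z j 0 = 0.
Proof.
have onesE : ((const_mx 1 : 'cV[R]_k)^T *m z) 0 0 = \sum_(j < k) z j 0.
  by rewrite mxE; apply: eq_bigr => j _; rewrite !mxE mul1r.
split=> [z0|z0]; first by rewrite -onesE z0 mxE.
by apply/matrixP => i j; rewrite !ord1 onesE z0 mxE.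
Qed.

Lemma lin_diffset_face (R : realType) (m k : nat) (idx : 'I_k -> 'I_m)
    (S : {set 'I_m}) (idx_inj : injective idx)
    (idx_im : [set idx j | j : 'I_k]%SET = S) (S_neq0 : S != finset.set0) :
  lin (diffset (face R S) (face R S)) =
    [set selmx R idx *m z | z in [set z : 'cV[R]_k | \sum_(j < k) z j 0 = 0]].
Proof.
apply/seteqP; split=> [_ [N [c [x [xD ->]]]]|_ [z /= z0 <-]].
- (* Vectors supported on [S] with zero sum form a subspace, so it suffices that
     [E^T] pulls back each difference of points of the face to zero sum. *)
  have xE l : selmx R idx *m ((selmx R idx)^T *m x l) = x l /\
      \sum_(j < k) ((selmx R idx)^T *m x l) j 0 = 0.
    have [p pF [q qF <-]] := xD l; split.
      by rewrite (selmx_mulVK idx_inj idx_im) // => i iS;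
        rewrite !mxE pF.2 // qF.2 // subrr.
    under eq_bigr do rewrite mulmxBr mxE [X in _ + X]mxE.
    rewrite sumrB (simplex_tr_selmx idx_inj idx_im pF).2.
    by rewrite (simplex_tr_selmx idx_inj idx_im qF).2 subrr.
  exists (\sum_(l < N) c l *: ((selmx R idx)^T *m x l)) => /=.
    under eq_bigr do rewrite summxE.
    rewrite exchange_big big1 //= => l _.
    by under eq_bigr do rewrite mxE; rewrite -mulr_sumr (xE l).2 mulr0.
  by rewrite mulmx_sumr; apply: eq_bigr => l _; rewrite -scalemxAr (xE l).1.
- have [i0 i0S] := set0Pn _ S_neq0.
  have /imsetP[j0 _ _] : i0 \in [set idx j | j : 'I_k]%SET by rewrite idx_im.
  exists k, (fun j => z j 0),
    (fun j => selmx R idx *m stdbasis R j - selmx R idx *m stdbasis R j0); split.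
    move=> j; exists (selmx R idx *m stdbasis R j).
      exact: (face_selmx idx_im (simplex_stdbasis _ _)).
    exists (selmx R idx *m stdbasis R j0) => //.
    exact: (face_selmx idx_im (simplex_stdbasis _ _)).
  under eq_bigr do rewrite scalerBr.
  rewrite sumrB -scaler_suml z0 scale0r subr0.
  rewrite {1}[z]matrix_sum_delta mulmx_sumr; apply: eq_bigr => j _.
  by rewrite big_ord1 scalemxAr.
Qed.

Theorem lemma7 (R : realType) (n m : nat) (hm : (1 <= m)%N)
    (A : 'M[R]_n) (b : 'I_m -> 'cV[R]_n) (T : R) (hT : 0 < T)
    (S : {set 'I_m}) (hS : S != finset.set0)
    (k : nat) (hk : k = #|S|) (idx : 'I_k -> 'I_m) (hinj : injective idx)
    (himg : [set idx j | j : 'I_k]%SET = S) :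
  [/\ (set_bij (simplex R k) (face R S) (fun q => selmx R idx *m q) /\
       forall p, face R S p ->
         exists! q, simplex R k q /\ p = selmx R idx *m q),
      forall q, simplex R k q ->
        Phi A b T (selmx R idx *m q) =
          \sum_(j < k) q j 0 *: gramian A (b (idx j)) T,
      forall z : 'cV[R]_m,
        eucl_proj (face R S) z =
          selmx R idx *m eucl_proj (simplex R k) ((selmx R idx)^T *m z)
    & lin (diffset (face R S) (face R S)) =
        [set selmx R idx *m z | z in [set z : 'cV[R]_k |
          (const_mx 1 : 'cV[R]_k)^T *m z = 0]] ].
Proof.
have faceP := face_selmxP (R := R) hinj himg.
split.
- split; last first.
    move=> p /faceP[q qD <-]; exists q; split=> // q' [_ qq'].
    exact: (can_inj (selmx_mulK hinj)) qq'.
  split=> [q qD|q q' _ _|p /faceP//]; first exact: (face_selmx himg).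
  exact: (can_inj (selmx_mulK hinj)).
- by move=> q _; exact: selmx_sum.
- by move=> z; exact: eucl_proj_face.
- rewrite (lin_diffset_face _ hinj himg hS); congr image.
  by apply/seteqP; split=> z /ones_mulmx_eq0.
Qed.
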